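(* Let $\pi=(\pi_1,\pi_2)$ with $\pi_1,\pi_2>0$, $\pi_1+\pi_2=1$, be the fixed stationary distribution of the channels considered, and suppose that $\Delta^2>(1-\theta)^2/3$ (a condition on $\pi$ only, since $\Delta=(1-\theta)(\pi_2-\pi_1)$; it says $(\pi_2-\pi_1)^2>1/3$). Then for every integer $d\ge 2$ the Kesten-Stigum bound is not tight. In other words, for every $d\geq 2$ there exists an admissible $\theta$ with $d\theta^2<1$ such that, with $\Delta=(1-\theta)(\pi_2-\pi_1)$, the reconstruction problem for the channel $\mathbf{M}$ with parameters $(\theta,\Delta)$ on the infinite $d$-ary tree is solvable.
   Context: Channel. For real $\theta,\Delta$ with $|\theta|+|\Delta|\le 1$, let $\mathbf{M}=(M_{ij})_{i,j\in\{1,2\}}$ be the stochastic matrix $$\mathbf{M}=\frac12\left[\begin{pmatrix}1+\theta&1-\theta\\1-\theta&1+\theta\end{pmatrix}+\Delta\begin{pmatrix}-1&1\\-1&1\end{pmatrix}\right],$$ assumed irreducible and aperiodic. Its stationary distribution is $\pi_1=\frac12-\frac{\Delta}{2(1-\theta)}$, $\pi_2=\frac12+\frac{\Delta}{2(1-\theta)}$; equivalently $\Delta=(1-\theta)(\pi_2-\pi_1)$. Given $\pi$, a value $\theta$ is called admissible if, with $\Delta=(1-\theta)(\pi_2-\pi_1)$, we have $|\theta|+|\Delta|\le1$ and $\mathbf{M}$ is irreducible and aperiodic. Broadcast process. Let $\mathbb{T}$ be the infinite rooted $d$-ary tree (every vertex has exactly $d$ children) with root $\rho$. The spin $\sigma_\rho\in\{1,2\}$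 is chosen according to $\pi$; then, independently along edges, if $v$ is a child of $u$, $\mathbf{P}(\sigma_v=j\mid\sigma_u=i)=M_{ij}$. Let $\sigma(n)$ be the collection of spins at distance $n$ from the root, and $\sigma^i(n)$ denote $\sigma(n)$ conditioned on $\sigma_\rho=i$. Reconstruction. The reconstruction problem is solvable if for some $i,j\in\{1,2\}$, $\limsup_{n\to\infty}d_{TV}(\sigma^i(n),\sigma^j(n))>0$, where $d_{TV}$ is the total variation distance between the laws; otherwise (the $\limsup$ is $0$) the model has non-reconstruction. Kesten-Stigum bound. It is known that reconstruction is solvable whenever $d\theta^2>1$. For given $\pi$ and $d$, the Kesten-Stigum bound is tight (sharp) if there is non-reconstruction for every admissible $\theta$ with $d\theta^2<1$. *)

(* Defs.v *)
From HB Require Import structures.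
From mathcomp Require Import all_boot all_order all_algebra ring.
From mathcomp Require Import all_classical all_reals all_analysis.

Set Implicit Arguments.
Unset Strict Implicit.
Unset Printing Implicit Defensive.

Import Order.TTheory GRing.Theory Num.Theory.
Import numFieldNormedType.Exports.
Local Open Scope ring_scope.

(* The spins 1 and 2 are the elements 0 and 1 of 'I_2; a distribution p on the
   spins is a row vector, with p 0 0 and p 0 1 for pi_1 and pi_2. *)

Section MarkovChain.
Variables (R : realType) (k : nat).
Implicit Type M : 'M[R]_k.+1.

Definition irreducible_chain M : Prop :=
  forall i j, exists n, 0 < (M ^+ n) i j.

(* For every state i, the gcd of the possible return times to i is 1. *)
Definition aperiodic_chain M : Prop :=
  forall i (q : nat),
    (forall n, (0 < n)%N -> 0 < (M ^+ n) i i -> (q %| n)%N) -> q = 1%N.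

End MarkovChain.

Section Channel.
Variable R : realType.
Implicit Types (theta Delta : R) (p : 'rV[R]_2).

Definition channel theta Delta : 'M[R]_2 :=
  2^-1 *: (\matrix_(i, j) (if i == j then 1 + theta else 1 - theta) +
           Delta *: \matrix_(i, j) (if j == 0 then -1 else 1)).

Definition Delta_of p theta : R := (1 - theta) * (p 0 1 - p 0 0).

Definition channel_of p theta : 'M[R]_2 := channel theta (Delta_of p theta).

Definition admissible p theta : Prop :=
  [/\ `|theta| + `|Delta_of p theta| <= 1,
      irreducible_chain (channel_of p theta) &
      aperiodic_chain (channel_of p theta)].

Lemma channel_of_stochastic p theta i : \sum_j channel_of p theta i j = 1.
Proof.
rewrite big_ord_recr big_ord1 !mxE /=.
by case: i => -[|[|//]] ilt2 /=; field.
Qed.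

Lemma channel_of_stationary p theta :
  p 0 0 + p 0 1 = 1 -> p *m channel_of p theta = p.
Proof.
move=> p1; have p0E : p 0 0 = 1 - p 0 1 by rewrite -p1 addrK.
apply/rowP => j; rewrite !mxE big_ord_recr big_ord1 !mxE /=.
have -> : widen_ord (leqnSn 1) ord0 = 0 :> 'I_2 by apply/val_inj.
have -> : ord_max = 1 :> 'I_2 by apply/val_inj.
rewrite /Delta_of; have [->|->] : j = 0 \/ j = 1.
- by case: j => -[|[|//]] jlt2; [left|right]; apply/val_inj.
- by rewrite /= p0E; field.
- by rewrite /= p0E; field.
Qed.

End Channel.

(* A vertex of the infinite d-ary tree is the word in seq 'I_d of the branches
   taken from the root: the root is the empty word, the children of u are the
   words rcons u c for c : 'I_d, and the distance from the root is the length.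
   The vertices at distance n form n.-tuple 'I_d, those at distance at most n
   form n.-bseq 'I_d. *)
Section Broadcast.
Variables (R : realType) (d : nat) (p : 'rV[R]_2) (M : 'M[R]_2).

(* Joint law of the spins at distance at most n from the root. As size u < n,
   insub_bseq only casts the word rcons u c to n.-bseq 'I_d. *)
Definition broadcast_law n (s : {ffun n.-bseq 'I_d -> 'I_2}) : R :=
  p 0 (s [bseq]) *
  \prod_(u : n.-bseq 'I_d | (size u < n)%N) \prod_(c < d)
     M (s u) (s (insub_bseq n (rcons u c))).

Definition broadcast_pr n (E : pred {ffun n.-bseq 'I_d -> 'I_2}) : R :=
  \sum_(s | E s) broadcast_law s.

Definition level_spins n (s : {ffun n.-bseq 'I_d -> 'I_2}) :
    {ffun n.-tuple 'I_d -> 'I_2} :=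
  [ffun v : n.-tuple 'I_d => s (bseq_of_tuple v)].

(* Law of sigma(n) conditioned on the event that the root has spin i. *)
Definition level_law (i : 'I_2) n (t : {ffun n.-tuple 'I_d -> 'I_2}) : R :=
  broadcast_pr (fun s : {ffun n.-bseq 'I_d -> 'I_2} =>
                  (level_spins s == t) && (s [bseq] == i)) /
  broadcast_pr (fun s : {ffun n.-bseq 'I_d -> 'I_2} => s [bseq] == i).

End Broadcast.

Definition dTV (R : realType) (T : finType) (mu nu : T -> R) : R :=
  2^-1 * \sum_x `|mu x - nu x|.

Definition reconstruction_solvable (R : realType) (d : nat)
    (p : 'rV[R]_2) (M : 'M[R]_2) : Prop :=
  exists i j : 'I_2,
    (0 < limn_esup (fun n => (dTV (@level_law R d p M i n)
                                  (@level_law R d p M j n))%:E))%E.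

Definition non_reconstruction (R : realType) (d : nat)
    (p : 'rV[R]_2) (M : 'M[R]_2) : Prop :=
  ~ reconstruction_solvable d p M.

Definition Kesten_Stigum_tight (R : realType) (d : nat) (p : 'rV[R]_2) : Prop :=
  forall theta : R, admissible p theta -> d%:R * theta ^+ 2 < 1 ->
    non_reconstruction d p (channel_of p theta).

(* Main.v *)
Require Import Defs.
From mathcomp Require Import all_boot all_order all_algebra ring lra.
From mathcomp Require Import all_classical all_reals all_analysis.
Set Implicit Arguments.
Unset Strict Implicit.
Unset Printing Implicit Defensive.
Import Order.TTheory GRing.Theory Num.Theory.
Local Open Scope ring_scope.

(** Write P_i for the law of the spins at level n given a root with spin i,
    Q = pi_1 P_1 + pi_2 P_2 for their mixture, and Y = (P_1 - P_2) / Q for the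
    magnetization, so that P_i = Q (1 + s_i Y) with s_1 = pi_2 and
    s_2 = - pi_1.  As Y is bounded, the total variation distance of P_1 and P_2
    is at least a constant times x_n = E_Q Y^2 ([magn2_le_dist]), and it is
    enough to keep x_n away from 0 for some theta with d theta^2 < 1.

    Given the magnetizations Y_1, ..., Y_d seen in the subtrees of the children,
    put A = prod_k (1 + theta pi_2 Y_k), B = prod_k (1 - theta pi_1 Y_k),
    N = A - B and Z = pi_1 A + pi_2 B.  The magnetization of the parent is N / Z
    under the density Z.  Since 1 / Z >= 2 - Z for Z > 0,
      x_{n+1} = E (N^2 / Z) >= 2 E N^2 - E (N^2 Z),
    and the right-hand side is an explicit polynomial in u = theta^2 x_n and
    v = theta^3 w_n, where w_n = E_Q Y^3 ([magn2_step_ge]).  With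
    q = pi_1 pi_2 and delta = pi_2 - pi_1 it equals
      d u + binom(d, 2) ((delta^2 - 2 q) u^2 - 4 q delta u v - q delta^2 v^2)
    up to O(u^3) ([moments_expansion]).  As q = (1 - delta^2) / 4, the condition
    delta^2 > 1/3 says exactly that delta^2 - 2 q > 0.

    It remains to see that w_n becomes negligible against x_n.  To first order
    w_{n+1} is d theta^3 w_n = (d theta^2) theta w_n, while x_{n+1} is
    d theta^2 x_n, so w_n / x_n contracts by the factor theta < 1 as long as x_n
    is small ([magn3_step_le]).  When x_n drops below a small level, the
    ratio is therefore small after a bounded number of steps, in which x_n has
    lost at most a fixed factor; from then on x_n no longer decreases, provided
    that 1 - d theta^2 is small compared with the value reached
    ([magnetization_persists]).  All constants are uniform in theta
    ([broadcast_step_dynamics]), so d theta^2 < 1 can be chosen after them.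

    The lemmas write 0 and 1 for the spins 1 and 2, and p0 and p1 for pi_1 and
    pi_2. *)

(** * Second-order expansion of the moments *)

Lemma pow1D_taylor2 (R : realFieldType) (d : nat) (B : R) : 0 <= B ->
  exists2 C, 0 <= C & forall t, `|t| <= B ->
    `|(1 + t) ^+ d - (1 + d%:R * t + 'C(d, 2)%:R * t ^+ 2)| <= C * `|t| ^+ 3.
Proof.
move=> B0; elim: d => [|d [C C0 IH]].
  exists 0 => // t _.
  by rewrite expr0 bin0n /= !mul0r !addr0 subrr normr0.
exists ((1 + B) * C + 'C(d, 2)%:R) => [|t tB].
  by rewrite addr_ge0 // mulr_ge0 // addr_ge0.
have -> : (1 + t) ^+ d.+1 - (1 + d.+1%:R * t + 'C(d.+1, 2)%:R * t ^+ 2) =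
  (1 + t) * ((1 + t) ^+ d - (1 + d%:R * t + 'C(d, 2)%:R * t ^+ 2))
  + 'C(d, 2)%:R * t ^+ 3.
  by rewrite binS bin1 natrD exprS -(natr1 d); ring.
rewrite (le_trans (ler_normD _ _)) // [leRHS]mulrDl lerD //.
  rewrite normrM -mulrA ler_pM //; last exact: IH.
  by rewrite (le_trans (ler_normD _ _)) // normr1 lerD2l.
by rewrite normrM normrX ger0_norm.
Qed.

(** The form in which the expansion is used: t is a linear form in u and v, and
    v is bounded by a multiple of u. *)
Lemma pow1D_scaled (R : realFieldType) (d : nat) (c U : R) : 0 <= c -> 0 <= U ->
  exists2 K, 0 <= K & forall t u, 0 <= u -> u <= U -> `|t| <= c * u ->
    `|(1 + t) ^+ d - (1 + d%:R * t + 'C(d, 2)%:R * t ^+ 2)| <= K * u ^+ 3 /\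
    `|(1 + t) ^+ d - (1 + d%:R * t)| <= K * u ^+ 2.
Proof.
move=> c0 U0; have [C C0 HC] := pow1D_taylor2 d (mulr_ge0 c0 U0).
set b : R := 'C(d, 2)%:R; have b0 : 0 <= b by rewrite ler0n.
exists (C * c ^+ 3 * (1 + U) + b * c ^+ 2) => [|t u u0 uU tu].
  by rewrite addr_ge0 ?mulr_ge0 ?exprn_ge0 ?addr_ge0.
have {HC} := HC t (le_trans tu (ler_wpM2l c0 uU)); rewrite -/b => HC.
have t3 : C * `|t| ^+ 3 <= C * c ^+ 3 * u ^+ 3.
  by rewrite -mulrA -exprMn ler_wpM2l // lerXn2r ?nnegrE ?mulr_ge0.
have t2 : `|b * t ^+ 2| <= b * c ^+ 2 * u ^+ 2.
  rewrite normrM (ger0_norm b0) -mulrA -exprMn ler_wpM2l // normrX.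
  by rewrite lerXn2r ?nnegrE ?mulr_ge0.
have Cc0 : 0 <= C * c ^+ 3 by rewrite mulr_ge0 ?exprn_ge0.
have bc0 : 0 <= b * c ^+ 2 by rewrite mulr_ge0 ?exprn_ge0.
have u3 : 0 <= u ^+ 3 by rewrite exprn_ge0.
have u2 : 0 <= u ^+ 2 by rewrite exprn_ge0.
split.
  apply: le_trans HC (le_trans t3 _); rewrite ler_wpM2r // -{1}[C * _]mulr1.
  by rewrite -[leLHS]addr0 lerD // ler_wpM2l // lerDl.
have -> : (1 + t) ^+ d - (1 + d%:R * t) =
   ((1 + t) ^+ d - (1 + d%:R * t + b * t ^+ 2)) + b * t ^+ 2 by ring.
rewrite (le_trans (ler_normD _ _)) // [leRHS]mulrDl lerD //.
apply: le_trans HC (le_trans t3 _).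
rewrite -!mulrA !ler_wpM2l // ?exprn_ge0 //.
by rewrite exprS ler_wpM2r // (le_trans uU) // lerDr.
Qed.

Lemma coefficient_bounds (R : realFieldType) (p0 p1 : R) :
  0 <= p0 -> 0 <= p1 -> p0 + p1 = 1 ->
  [/\ `|p1 ^+ 2| <= 3, `|- (p0 * p1)| <= 3, `|3 * p1 ^+ 2| <= 3
    & `|p1 ^+ 2 - 2 * p0 * p1| <= 3] /\
  [/\ `|p1 ^+ 3| <= 1, `|- (p1 ^+ 2 * p0)| <= 1, `|2 * p0 * p1| <= 4
    & `|- (p1 - 2 * p0)| <= 4 /\ `|- p0| <= 4].
Proof.
move=> p0_ge0 p1_ge0 p01.
have p0_le1 : p0 <= 1 by rewrite -p01 lerDl.
have p1_le1 : p1 <= 1 by rewrite -p01 lerDr.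
have s0 : 0 <= p1 ^+ 2 by rewrite exprn_ge0.
have s1 : p1 ^+ 2 <= 1 by rewrite exprn_ile1.
have q0 : 0 <= p0 * p1 by rewrite mulr_ge0.
have q1 : p0 * p1 <= 1 by rewrite mulr_ile1.
have c0 : 0 <= p1 ^+ 3 by rewrite exprn_ge0.
have c1 : p1 ^+ 3 <= 1 by rewrite exprn_ile1.
have e0 : 0 <= p1 ^+ 2 * p0 by rewrite mulr_ge0.
have e1 : p1 ^+ 2 * p0 <= 1 by rewrite mulr_ile1.
by split; split; try split; rewrite ler_norml; apply/andP; split; lra.
Qed.

Section Moments.
Variables (R : realFieldType) (d : nat) (p0 p1 : R).
Local Notation pw t := ((1 + t) ^+ d).

(** With A, B, N and Z as above, these are the values of E N^2, E (1 - Z)^2,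
    E (N^2 Z) and E N^3 as functions of u = theta^2 E Y^2 and
    v = theta^3 E Y^3: each E (A^i B^j) is the d-th power of the expectation of
    (1 + theta p1 Y)^i (1 - theta p0 Y)^j. *)
Definition moment_N2 (u : R) :=
  pw (p1 ^+ 2 * u) - 2 * pw (- (p0 * p1) * u) + pw (p0 ^+ 2 * u).
Definition moment_Z2 (u : R) :=
  p0 ^+ 2 * pw (p1 ^+ 2 * u) + 2 * p0 * p1 * pw (- (p0 * p1) * u)
  + p1 ^+ 2 * pw (p0 ^+ 2 * u) - 1.
Definition moment_N2Z (u v : R) :=
  p0 * pw (3 * p1 ^+ 2 * u + p1 ^+ 3 * v)
  + (p1 - 2 * p0) * pw ((p1 ^+ 2 - 2 * p0 * p1) * u - p1 ^+ 2 * p0 * v)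
  + (p0 - 2 * p1) * pw ((p0 ^+ 2 - 2 * p0 * p1) * u + p0 ^+ 2 * p1 * v)
  + p1 * pw (3 * p0 ^+ 2 * u - p0 ^+ 3 * v).
Definition moment_N3 (u v : R) :=
  pw (3 * p1 ^+ 2 * u + p1 ^+ 3 * v)
  - 3 * pw ((p1 ^+ 2 - 2 * p0 * p1) * u - p1 ^+ 2 * p0 * v)
  + 3 * pw ((p0 ^+ 2 - 2 * p0 * p1) * u + p0 ^+ 2 * p1 * v)
  - pw (3 * p0 ^+ 2 * u - p0 ^+ 3 * v).

(** All first-order terms cancel in E (1 - Z)^2 because p0 p1 - p1 p0 = 0, and
    those in u cancel in E N^3.  The quadratic form in the last bound decides the
    theorem: when v is small compared with u, its sign is that of
    (p1 - p0)^2 - 2 p0 p1. *)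
Lemma moments_expansion (m U : R) :
  0 <= p0 -> 0 <= p1 -> p0 + p1 = 1 -> 0 <= m -> 0 <= U ->
  exists2 C, 0 <= C & forall u v, 0 <= u -> u <= U -> `|v| <= m * u ->
   [/\ `|moment_N2 u - d%:R * u| <= C * u ^+ 2,
       `|moment_Z2 u| <= C * u ^+ 2,
       `|moment_N3 u v - d%:R * v| <= C * u ^+ 2 &
       `|2 * moment_N2 u - moment_N2Z u v - (d%:R * u + 'C(d, 2)%:R *
          (((p1 - p0) ^+ 2 - 2 * p0 * p1) * u ^+ 2
           - 4 * p0 * p1 * (p1 - p0) * u * v
           - p0 * p1 * (p1 - p0) ^+ 2 * v ^+ 2))| <= C * u ^+ 3].
Proof.
move=> p0_ge0 p1_ge0 p01 m0 U0.
have p1E : p1 = 1 - p0 by rewrite -p01 addrAC subrr add0r.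
have [[a1 a2 a4 a5] [b4 b5 w2 [w5 w4]]] := coefficient_bounds p0_ge0 p1_ge0 p01.
have [[a3 _ a7 a6] [b7 b6 _ [w6 w7]]] :=
  coefficient_bounds p1_ge0 p0_ge0 (etrans (addrC _ _) p01).
rewrite normrN in b6; rewrite -normrN in b7; rewrite -(mulrAC 2) in a6.
have w1 := le_trans a3 (ltac:(by rewrite ler_nat) : 3 <= 4 :> R).
have w3 := le_trans a1 (ltac:(by rewrite ler_nat) : 3 <= 4 :> R).
have small (k : nat) : (k <= 4)%N -> `|k%:R : R| <= 4 /\ `|- k%:R : R| <= 4.
  by move=> k4; rewrite normrN normr_nat ler_nat.
have [[y1 y7] [y3 y2]] := (small 1%N isT, small 2%N isT).
have [[y6 y5] [_ y4]] := (small 3%N isT, small 4%N isT).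
have c0 : 0 <= 3 + m by rewrite addr_ge0.
have [K K0 HK] := pow1D_scaled d c0 U0.
(* Each of the at most seven powers enters with a coefficient of size at most 4. *)
exists (28 * K) => [|u v u0 uU vu]; first by rewrite mulr_ge0.
have bnd (a b : R) : `|a| <= 3 -> `|b| <= 1 -> `|a * u + b * v| <= (3 + m) * u.
  move=> a3' b1; rewrite (le_trans (ler_normD _ _)) // mulrDl lerD // normrM.
    by rewrite (ger0_norm u0) ler_wpM2r.
  by rewrite (le_trans _ vu) // ler_piMl.
have bnd0 (a : R) : `|a| <= 3 -> `|a * u| <= (3 + m) * u.
  move=> a3'; have := @bnd a 0 a3'.
  by rewrite mul0r addr0 normr0; apply; rewrite ler01.
have [A1 B1] := HK _ _ u0 uU (bnd0 _ a1).
have [A2 B2] := HK _ _ u0 uU (bnd0 _ a2).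
have [A3 B3] := HK _ _ u0 uU (bnd0 _ a3).
have [A4 B4] := HK _ _ u0 uU (bnd _ _ a4 b4).
have [A5 B5] := HK _ _ u0 uU (bnd _ _ a5 b5).
have [A6 B6] := HK _ _ u0 uU (bnd _ _ a6 b6).
have [A7 B7] := HK _ _ u0 uU (bnd _ _ a7 b7).
have wt (k r x : R) : `|k| <= 4 -> `|x| <= r -> `|k * x| <= 4 * r.
  by move=> k3 xr; rewrite normrM ler_pM.
have add (x y kx ky r : R) : `|x| <= kx * r -> `|y| <= ky * r ->
    `|x + y| <= (kx + ky) * r.
  by move=> hx hy; rewrite (le_trans (ler_normD _ _)) // mulrDl lerD.
have ru2 : 0 <= K * u ^+ 2 by rewrite mulr_ge0 ?exprn_ge0.
have le28 (x k : R) : `|x| <= k * (K * u ^+ 2) -> k <= 28 ->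
    `|x| <= 28 * K * u ^+ 2.
  by move=> hx hk; rewrite -mulrA (le_trans hx) // ler_wpM2r.
rewrite /moment_N2 /moment_Z2 /moment_N3 /moment_N2Z !mulNr.
rewrite !mulNr in A2 B2 A5 B5 A7 B7.
move: A1 A2 A3 A4 A5 A6 A7 B1 B2 B3 B4 B5 B6 B7.
move: 'C(d, 2)%:R d%:R => b D.
move: ((1 + p1 ^+ 2 * u) ^+ d) ((1 - p0 * p1 * u) ^+ d)
  ((1 + p0 ^+ 2 * u) ^+ d) ((1 + (3 * p1 ^+ 2 * u + p1 ^+ 3 * v)) ^+ d)
  ((1 + ((p1 ^+ 2 - 2 * p0 * p1) * u - p1 ^+ 2 * p0 * v)) ^+ d)
  ((1 + ((p0 ^+ 2 - 2 * p0 * p1) * u + p0 ^+ 2 * p1 * v)) ^+ d)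
  ((1 + (3 * p0 ^+ 2 * u - p0 ^+ 3 * v)) ^+ d) => e1 e2 e3 e4 e5 e6 e7.
move=> A1 A2 A3 A4 A5 A6 A7 B1 B2 B3 B4 B5 B6 B7.
split.
- apply: (le28 _ (4 + 4 + 4)); last by rewrite -!natrD ler_nat.
  have := add _ _ _ _ _ (add _ _ _ _ _ (wt _ _ _ y1 B1) (wt _ _ _ y2 B2))
    (wt _ _ _ y1 B3).
  by congr (`| _ | <= _); rewrite p1E; ring.
- apply: (le28 _ (4 + 4 + 4)); last by rewrite -!natrD ler_nat.
  have := add _ _ _ _ _ (add _ _ _ _ _ (wt _ _ _ w1 B1) (wt _ _ _ w2 B2))
    (wt _ _ _ w3 B3).
  by congr (`| _ | <= _); rewrite p1E; ring.
- apply: (le28 _ (4 + 4 + 4 + 4)); last by rewrite -!natrD ler_nat.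
  have := add _ _ _ _ _ (add _ _ _ _ _ (add _ _ _ _ _
    (wt _ _ _ y1 B4) (wt _ _ _ y5 B5)) (wt _ _ _ y6 B6)) (wt _ _ _ y7 B7).
  by congr (`| _ | <= _); rewrite p1E; ring.
- have -> : 28 * K * u ^+ 3 = (4 + 4 + 4 + 4 + 4 + 4 + 4) * (K * u ^+ 3) by ring.
  have := add _ _ _ _ _ (add _ _ _ _ _ (add _ _ _ _ _ (add _ _ _ _ _
    (add _ _ _ _ _ (add _ _ _ _ _
    (wt _ _ _ y3 A1) (wt _ _ _ y4 A2)) (wt _ _ _ y3 A3)) (wt _ _ _ w4 A4))
    (wt _ _ _ w5 A5)) (wt _ _ _ w6 A6)) (wt _ _ _ w7 A7).
  by congr (`| _ | <= _); rewrite p1E; ring.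
Qed.
End Moments.

(** * Persistence of the second moment *)

Lemma geometric_small (R : archiRealFieldType) (m e : R) : 0 <= m -> 0 < e ->
  exists N, (9 / 10) ^+ N * m <= e.
Proof.
(* Bernoulli's inequality for 10 / 9, in a form without inverses. *)
move=> m0 e0; have bern N : (9 / 10 : R) ^+ N * (9 + N%:R) <= 9.
  elim: N => [|N IH]; first by rewrite expr0 mul1r addr0.
  apply: le_trans IH; rewrite exprS -mulrA mulrCA ler_wpM2l ?exprn_ge0 ?divr_ge0 //.
  by have := ler0n R N; rewrite -natr1; lra.
have b0 : 0 <= 9 * m / e by rewrite divr_ge0 ?mulr_ge0 // ltW.
have := archi_boundP b0; move: (Num.bound _) => N bN.
have mN : 9 * m <= e * N%:R.
  by rewrite [leRHS]mulrC -ler_pdivrMr // ltW.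
exists N; have {bern} := bern N; move: ((9 / 10) ^+ N) => r rN.
have [/lt_le_trans r0|r0] := ltP (r * m) 0; first exact/ltW/r0/ltW.
have N0 : 0 < 9 + N%:R :> R by rewrite ltr_wpDr.
rewrite -(ler_pM2r N0) mulrAC (le_trans (ler_wpM2r m0 rN)) // mulrDr.
by rewrite (le_trans mN) // lerDr mulr_ge0 // ltW.
Qed.

Section Dynamics.
Variables (R : archiRealFieldType) (a b C c m : R) (K : R -> R).
Hypotheses (a0 : 0 < a) (b0 : 0 <= b) (C0 : 0 <= C) (c0 : 0 < c) (m0 : 0 <= m).
Hypothesis K0 : forall t, 0 < t -> 0 <= K t.

(** Here x and w stand for the second and third moments of the magnetization and
    l for d theta^2.  The ratio |w| / x never exceeds m.  While x is at most a
    threshold d1, each step multiplies a bound on the ratio by 9/10 until the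
    bound eta is reached, and costs x a factor c at worst.  Once the ratio is
    below eta, the quadratic gain a x^2 beats both error terms, and it beats the
    loss (1 - l) x as soon as 1 - l <= (a / 2) xmin. *)
Lemma magnetization_persists : exists2 e, 0 < e & exists2 xmin, 0 < xmin &
  forall (l : R) (x w : nat -> R), 1 - e <= l -> l <= 1 -> 1 <= x 0%N ->
    (forall n, `|w n| <= m * x n) -> (forall n, c * x n <= x n.+1) ->
    (forall n, l * x n + a * x n ^+ 2 - b * x n * `|w n| - C * x n ^+ 3
       <= x n.+1) ->
    (forall n t, 0 < t ->
       `|w n.+1| <= 3 / 4 * `|w n| + t * x n + K t * x n ^+ 2) ->
  forall n, xmin <= x n.
Proof.
have b1 : 0 < b + 1 by rewrite ltr_wpDl.
(* A ratio below eta makes the term b x |w| at most a quarter of a x^2. *)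
pose eta := a / (4 * (b + 1)).
have eta0 : 0 < eta by rewrite divr_gt0 // mulr_gt0.
have beta : b * eta <= a / 4.
  have -> : a / 4 = (b + 1) * eta by rewrite /eta; field; rewrite gt_eqF.
  by rewrite ler_pM2r // lerDl.
pose t := eta / 32; have t0 : 0 < t by rewrite divr_gt0.
have Kt := K0 t0.
(* The threshold 1 / S is small enough for the four bounds on d1 that follow. *)
pose S := 1 + 4 * C / a + 32 * K t / eta + 32 * b * m + 32 * C.
have t1 : 0 <= 4 * C / a by rewrite divr_ge0 ?mulr_ge0 // ltW.
have t2 : 0 <= 32 * K t / eta by rewrite mulr_ge0 ?mulr_ge0 ?invr_ge0 ?(ltW eta0).
have t3 : 0 <= 32 * b * m by rewrite !mulr_ge0.
have t4 : 0 <= 32 * C by rewrite !mulr_ge0.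
have S1 : 1 <= S by rewrite /S; lra.
have S0 : 0 < S := lt_le_trans ltr01 S1.
pose d1 := S^-1.
have d0 : 0 < d1 by rewrite invr_gt0.
have dS (A : R) : A <= S -> A * d1 <= 1 by move=> AS; rewrite ler_pdivrMr ?mul1r.
have d11 : d1 <= 1 by rewrite invf_le1.
have Cd1 : C * d1 <= a / 4.
  have : 4 * C / a * d1 <= 1 by apply: dS; rewrite /S; lra.
  by rewrite mulrAC ler_pdivrMr // mul1r; lra.
have Kd1 : K t * d1 <= eta / 32.
  have : 32 * K t / eta * d1 <= 1 by apply: dS; rewrite /S; lra.
  by rewrite mulrAC ler_pdivrMr // mul1r; lra.
have bd1 : (b * m + C) * d1 <= 1 / 32.
  have : (32 * b * m + 32 * C) * d1 <= 1 by apply: dS; rewrite /S; lra.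
  by lra.
have [N HN] := geometric_small m0 eta0.
(* The bound on the ratio, k steps after x was last above the threshold. *)
pose rho k := Order.max eta ((9 / 10) ^+ k * m).
(* A loss factor that is at most 1, so that its powers decrease. *)
pose c1 := Num.min c 1.
have c1_0 : 0 < c1 by rewrite lt_min c0 /=.
have c1_1 : c1 <= 1 by rewrite ge_min lexx orbT.
have c1c : c1 <= c by rewrite ge_min lexx.
pose xm := c1 ^+ N.+1 * d1.
have xm0 : 0 < xm by rewrite mulr_gt0 ?exprn_gt0.
exists (Num.min (1 / 32) (a / 2 * xm)).
  by rewrite lt_min divr_gt0 // mulr_gt0 // divr_gt0.
exists xm => // l x w le1 l1 x0 wm cx grow wgrow.
have l32 : 31 / 32 <= l.
  have : Num.min (1 / 32) (a / 2 * xm) <= 1 / 32 by rewrite ge_min lexx.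
  by lra.
have lxm : 1 - a / 2 * xm <= l.
  have : Num.min (1 / 32) (a / 2 * xm) <= a / 2 * xm.
    by rewrite ge_min lexx orbT.
  by lra.
(* The ratio of 3/4 r + eta/16 to 15/16 is at most 9/10 r when eta <= r. *)
have key n : 0 < x n -> x n <= d1 ->
    15 / 16 * x n <= x n.+1 /\
    (forall r, eta <= r -> `|w n| <= r * x n -> `|w n.+1| <= 9 / 10 * r * x n.+1).
  move=> xn0 xnd.
  have B : 15 / 16 * x n <= x n.+1.
    apply: le_trans (grow n).
    have h1 : b * x n * `|w n| <= b * m * d1 * x n.
      rewrite -!mulrA ler_wpM2l // mulrC (le_trans (ler_wpM2r (ltW xn0) (wm n))) //.
      by rewrite -mulrA ler_wpM2l // ler_wpM2r // ltW.
    have h2 : C * x n ^+ 3 <= C * d1 * x n.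
      rewrite -mulrA ler_wpM2l // exprSr ler_wpM2r ?(ltW xn0) //.
      rewrite expr2 -[leRHS]mulr1 ler_pM ?(ltW xn0) //.
      exact: le_trans xnd d11.
    have h3 : 31 / 32 * x n <= l * x n by rewrite ler_wpM2r // ltW.
    have h4 : (b * m + C) * d1 * x n <= 1 / 32 * x n by rewrite ler_wpM2r // ltW.
    have h5 : 0 <= a * x n ^+ 2 by rewrite mulr_ge0 ?exprn_ge0 // ltW.
    by lra.
  split=> // r etar wr.
  have r0 : 0 <= r := le_trans (ltW eta0) etar.
  have h1 : K t * x n ^+ 2 <= eta / 32 * x n.
    rewrite expr2 mulrA ler_wpM2r ?(ltW xn0) // (le_trans _ Kd1) //.
    by rewrite ler_wpM2l.
  have h2 : eta * x n <= r * x n by rewrite ler_wpM2r // ltW.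
  have h3 := ler_wpM2l r0 B.
  have h4 : t * x n = eta / 32 * x n by [].
  have h5 : 0 <= r * x n by rewrite mulr_ge0 // ltW.
  by have := wgrow n t t0; lra.
(* The counter k stops at N, where rho N = eta. *)
have inv n : exists2 k, (k <= N)%N & c1 ^+ k.+1 * d1 <= x n /\ `|w n| <= rho k * x n.
  have rho0 n' : 0 <= x n' -> `|w n'| <= rho 0%N * x n'.
    move=> xn'; rewrite (le_trans (wm n')) // ler_wpM2r //.
    by rewrite /rho expr0 mul1r le_max lexx orbT.
  elim: n => [|n [k kN [xk wk]]].
    exists 0%N => //; split; last by rewrite rho0 // (le_trans ler01 x0).
    by rewrite expr1 (le_trans _ x0) // mulr_ile1 // ltW.
  have xn0 : 0 < x n by apply: lt_le_trans xk; rewrite mulr_gt0 ?exprn_gt0.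
  have c1x : c1 * x n <= x n.+1 by rewrite (le_trans _ (cx n)) // ler_wpM2r // ltW.
  have xSn0 : 0 <= x n.+1 by rewrite (le_trans _ c1x) // mulr_ge0 // ltW.
  have [xnd|/ltW dxn] := leP (x n) d1; last first.
    exists 0%N => //; split; last exact: rho0.
    by rewrite expr1 (le_trans _ c1x) // ler_wpM2l // ltW.
  have [_ kw] := key n xn0 xnd.
  have etarho j : eta <= rho j by rewrite /rho le_max lexx.
  have {kw} wS := kw _ (etarho k) wk.
  move: kN; rewrite leq_eqVlt => /orP[/eqP kN|kN]; last first.
    exists k.+1 => //; split.
      by rewrite exprS -mulrA (le_trans _ c1x) // ler_wpM2l // ltW.
    rewrite (le_trans wS) // ler_wpM2r // /rho exprS -(mulrA _ _ m).
    case: (leP eta ((9 / 10) ^+ k * m)) => _; rewrite le_max.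
      by rewrite lexx orbT.
    by apply/orP; left; lra.
  have rhoN : rho k = eta by rewrite /rho kN; apply/max_idPl.
  exists k; rewrite ?rhoN ?kN //; rewrite rhoN in wS wk; split; last first.
    by rewrite (le_trans wS) // ler_wpM2r //; lra.
  rewrite -/xm; rewrite kN -/xm in xk.
  suff: x n <= x n.+1 by apply: le_trans.
  apply: le_trans (grow n).
  have h1 : b * x n * `|w n| <= a / 4 * x n ^+ 2.
    have := ler_wpM2l (ltW xn0) (ler_wpM2l b0 wk).
    by have := ler_wpM2r (sqr_ge0 (x n)) beta; lra.
  have h2 : C * x n ^+ 3 <= a / 4 * x n ^+ 2.
    rewrite exprS mulrA ler_wpM2r ?exprn_ge0 ?(ltW xn0) // (le_trans _ Cd1) //.
    by rewrite ler_wpM2l.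
  have h3 : a / 2 * xm * x n <= a / 2 * x n ^+ 2.
    by rewrite expr2 mulrA ler_wpM2r ?(ltW xn0) // ler_wpM2l // divr_ge0 // ltW.
  have h4 : (1 - a / 2 * xm) * x n <= l * x n by rewrite ler_wpM2r // ltW.
  by lra.
move=> n; have [k kN [xk _]] := inv n.
apply: le_trans xk; rewrite /xm ler_wpM2r ?(ltW d0) //.
by rewrite ler_wiXn2l // ltW.
Qed.
End Dynamics.

(** * One generation of the broadcast *)

Section Magnetization.
Variables (R : realFieldType) (p0 p1 : R).

Definition mixture (T : finType) (P0 P1 : T -> R) (t : T) : R :=
  p0 * P0 t + p1 * P1 t.
Definition magnetization (T : finType) (P0 P1 : T -> R) (t : T) : R :=
  (P0 t - P1 t) / mixture P0 P1 t.
Definition magn2 (T : finType) (P0 P1 : T -> R) : R :=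
  \sum_t mixture P0 P1 t * magnetization P0 P1 t ^+ 2.
Definition magn3 (T : finType) (P0 P1 : T -> R) : R :=
  \sum_t mixture P0 P1 t * magnetization P0 P1 t ^+ 3.

(** The law of the observations of d independent subtrees whose observations
    have the laws P0 and P1 given the spins of the children.  The parameter c is
    the value at the spin of the parent of the eigenvector (p1, - p0) of the
    channel for the eigenvalue theta. *)
Definition broadcast_step (T : finType) (d : nat) (theta c : R)
    (P0 P1 : T -> R) (f : {ffun 'I_d -> T}) : R :=
  \prod_k (mixture P0 P1 (f k) + theta * c * (P0 (f k) - P1 (f k))).

Hypotheses (p0_gt0 : 0 < p0) (p1_gt0 : 0 < p1) (p01 : p0 + p1 = 1).
Local Notation m := (p0 * p1)^-1.

Let m_gt0 : 0 < m. Proof. by rewrite invr_gt0 mulr_gt0. Qed.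
Let p1E : p1 = 1 - p0. Proof. by rewrite -p01 addrAC subrr add0r. Qed.
Let p0_le1 : p0 <= 1. Proof. by rewrite -p01 lerDl ltW. Qed.
Let p1_le1 : p1 <= 1. Proof. by rewrite -p01 lerDr ltW. Qed.

Lemma mixture_dominates_diff (a b : R) : 0 <= a -> 0 <= b ->
  `|a - b| <= m * (p0 * a + p1 * b).
Proof.
move=> a0 b0; rewrite mulrC ler_pdivlMr ?mulr_gt0 //.
have q0 : 0 <= p0 * p1 by rewrite ltW ?mulr_gt0.
rewrite (le_trans (ler_wpM2r q0 (ler_normB _ _))) // !ger0_norm // mulrDl.
by rewrite lerD // mulrC ler_wpM2r // ?ger_pMr // ger_pMl.
Qed.

Section Law.
Variables (T : finType) (P0 P1 : T -> R).
Hypotheses (P0_ge0 : forall t, 0 <= P0 t) (P1_ge0 : forall t, 0 <= P1 t).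
Hypotheses (P0_sum : \sum_t P0 t = 1) (P1_sum : \sum_t P1 t = 1).
Local Notation Q := (mixture P0 P1).
Local Notation Y := (magnetization P0 P1).

Lemma mixture_ge0 t : 0 <= Q t.
Proof. by rewrite addr_ge0 ?mulr_ge0 // ltW. Qed.

Lemma mixture_sum : \sum_t Q t = 1.
Proof. by rewrite big_split -!mulr_sumr P0_sum P1_sum !mulr1. Qed.

(** Where the mixture vanishes, the quotient defining the magnetization is 0, and
    so is the difference of the two laws. *)
Lemma mixture_magnetization t : Q t * Y t = P0 t - P1 t.
Proof.
rewrite /magnetization mulrC; have [Q0|Q0] := eqVneq (Q t) 0; last by rewrite divfK.
have := mixture_dominates_diff (P0_ge0 t) (P1_ge0 t).
by rewrite -/(mixture P0 P1 t) Q0 !mulr0 normr_le0 => /eqP ->.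
Qed.

Lemma posterior0 t : P0 t = Q t * (1 + p1 * Y t).
Proof.
rewrite mulrDr mulr1 mulrCA mixture_magnetization /mixture.
by rewrite p1E; ring.
Qed.

Lemma posterior1 t : P1 t = Q t * (1 - p0 * Y t).
Proof.
rewrite mulrBr mulr1 mulrCA mixture_magnetization /mixture.
by rewrite p1E; ring.
Qed.

(** The last two bounds say that the posterior densities [posterior0] and
    [posterior1] are nonnegative. *)
Lemma magnetization_bounds t :
  [/\ `|Y t| <= m, -1 <= p1 * Y t & p0 * Y t <= 1].
Proof.
have [Q0|Q0] := eqVneq (Q t) 0.
  rewrite /magnetization Q0 invr0 !mulr0 normr0 ler01 lerN10 (ltW m_gt0).
  by split.
have {}Q0 : 0 < Q t by rewrite lt_def Q0 mixture_ge0.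
split.
- rewrite normrM normfV (ger0_norm (ltW Q0)) ler_pdivrMr //.
  exact: mixture_dominates_diff.
- rewrite -subr_ge0 opprK addrC -(pmulr_rge0 _ Q0) -posterior0; exact: P0_ge0.
- rewrite -subr_ge0 -(pmulr_rge0 _ Q0) -posterior1; exact: P1_ge0.
Qed.

Lemma magn2_ge0 : 0 <= magn2 P0 P1.
Proof. by rewrite sumr_ge0 // => t _; rewrite mulr_ge0 ?mixture_ge0 ?sqr_ge0. Qed.

Lemma normr_magn3_le : `|magn3 P0 P1| <= m * magn2 P0 P1.
Proof.
rewrite (le_trans (ler_norm_sum _ _ _)) // mulr_sumr ler_sum // => t _.
have [Ym _ _] := magnetization_bounds t.
rewrite normrM (ger0_norm (mixture_ge0 t)) mulrCA ler_wpM2l ?mixture_ge0 //.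
by rewrite normrX exprS real_normK ?num_real // ler_wpM2r ?sqr_ge0.
Qed.

Lemma magn2_le_dist : magn2 P0 P1 <= m * \sum_t `|P0 t - P1 t|.
Proof.
rewrite mulr_sumr ler_sum // => t _.
have [Ym _ _] := magnetization_bounds t.
rewrite expr2 mulrA mixture_magnetization (le_trans (ler_norm _)) //.
by rewrite normrM mulrC ler_wpM2r.
Qed.

Lemma magn2_le : magn2 P0 P1 <= 2 * m.
Proof.
rewrite (le_trans magn2_le_dist) // mulrC ler_wpM2r ?(ltW m_gt0) //.
have -> : 2 = \sum_t (P0 t + P1 t) by rewrite big_split P0_sum P1_sum.
apply: ler_sum => t _; rewrite (le_trans (ler_normB _ _)) //.
by rewrite !ger0_norm.
Qed.

(** The linear coefficient disappears because the magnetization has mean 0. *)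
Lemma sum_magnetization_cubic (c1 c2 c3 : R) :
  \sum_t Q t * (1 + c1 * Y t + c2 * Y t ^+ 2 + c3 * Y t ^+ 3) =
  1 + (c2 * magn2 P0 P1 + c3 * magn3 P0 P1).
Proof.
have Y0 : \sum_t Q t * Y t = 0.
  under eq_bigr do rewrite mixture_magnetization.
  by rewrite sumrB P0_sum P1_sum subrr.
have split4 t : Q t * (1 + c1 * Y t + c2 * Y t ^+ 2 + c3 * Y t ^+ 3) =
    Q t + c1 * (Q t * Y t) + c2 * (Q t * Y t ^+ 2) + c3 * (Q t * Y t ^+ 3).
  by ring.
under eq_bigr do rewrite split4.
by rewrite 3!big_split -!mulr_sumr /= Y0 mixture_sum mulr0 addr0 addrA.
Qed.

End Law.

Section Step.
Variables (T : finType) (P0 P1 : T -> R) (d : nat) (theta : R).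
Hypotheses (P0_ge0 : forall t, 0 <= P0 t) (P1_ge0 : forall t, 0 <= P1 t).
Hypotheses (P0_sum : \sum_t P0 t = 1) (P1_sum : \sum_t P1 t = 1).
Hypotheses (theta_ge0 : 0 <= theta) (theta_le : theta <= 3 / 4).
Local Notation Q := (mixture P0 P1).
Local Notation Y := (magnetization P0 P1).
Local Notation S0 := (@broadcast_step T d theta p1 P0 P1).
Local Notation S1 := (@broadcast_step T d theta (- p0) P0 P1).
Implicit Type f : {ffun 'I_d -> T}.

Let theta_le1 : theta <= 1. Proof. by have := theta_le; lra. Qed.
(* W is the density of the product of the mixtures; the laws of the observations
   given the spin of the parent have the densities A and B with respect to it. *)
Let W f := \prod_k Q (f k).
Let L c f := \prod_k (1 + theta * c * Y (f k)).
Let A f := L p1 f.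
Let B f := L (- p0) f.
Let N f := A f - B f.
Let Z f := p0 * A f + p1 * B f.

Let W_ge0 f : 0 <= W f.
Proof. by rewrite prodr_ge0 // => k _; rewrite mixture_ge0. Qed.

Let stepE c f : broadcast_step theta c P0 P1 f = W f * L c f.
Proof.
rewrite /W /L -big_split; apply: eq_bigr => k _ /=.
by rewrite [RHS]mulrDr mulr1 mulrCA mixture_magnetization.
Qed.

Let mixtureSE f : mixture S0 S1 f = W f * Z f.
Proof. by rewrite /mixture !stepE /Z /A /B; ring. Qed.

(* The bound 3 / 4 on theta keeps the factors, hence also Z, away from 0. *)
Let factor_bounds c t : c = p1 \/ c = - p0 ->
  1 / 4 <= 1 + theta * c * Y t <= 1 + m.
Proof.
move=> cE; have [Ym Y1 Y0] := magnetization_bounds P0_ge0 P1_ge0 t.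
have c1 : -1 <= c * Y t by case: cE => ->; rewrite ?mulNr ?lerN2.
have cm : c * Y t <= m.
  apply: le_trans (ler_norm _) _; rewrite normrM (le_trans _ Ym) // ler_piMl //.
  by case: cE => ->; rewrite ?normrN gtr0_norm.
have h1 := ler_wpM2l theta_ge0 c1; have h2 := ler_wpM2l theta_ge0 cm.
have h3 : theta * m <= m by rewrite ler_piMl // ltW.
rewrite -mulrA; move: (theta * (c * Y t)) h1 (le_trans h2 h3) => z h1 zm.
by have := theta_le; move=> th; apply/andP; split; last rewrite lerD2l //; lra.
Qed.

Let L_bounds c f : c = p1 \/ c = - p0 -> 4^-1 ^+ d <= L c f <= (1 + m) ^+ d.
Proof.
move=> cE; have b k := factor_bounds (f k) cE.
have cst x : x ^+ d = \prod_(k < d) x :> R by rewrite prodr_const card_ord.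
rewrite !cst; apply/andP; split.
  apply: ler_prod => k _; rewrite invr_ge0 ler0n /=.
  by have /andP[+ _] := b k; rewrite mul1r.
apply: ler_prod => k _; have /andP[h ->] := b k.
by rewrite andbT (le_trans _ h) // divr_ge0.
Qed.

Let convex (a b lo hi : R) : lo <= a <= hi -> lo <= b <= hi ->
  lo <= p0 * a + p1 * b <= hi.
Proof.
move=> /andP[la ah] /andP[lb bh].
rewrite -[lo]mul1r -[hi]mul1r -p01 !mulrDl.
by rewrite !lerD // ler_wpM2l // ltW.
Qed.

Let Z_bounds f : 4^-1 ^+ d <= Z f <= (1 + m) ^+ d.
Proof. by apply: convex; apply: L_bounds; [left|right]. Qed.

Let Z_gt0 f : 0 < Z f.
Proof.
have /andP[h _] := Z_bounds f; apply: lt_le_trans h.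
by rewrite exprn_gt0 // invr_gt0.
Qed.

Let N_le f : `|N f| <= m * Z f.
Proof.
have lo0 : 0 <= 4^-1 ^+ d :> R by rewrite exprn_ge0 // invr_ge0.
apply: mixture_dominates_diff; apply: le_trans lo0 _.
  by have /andP[] := L_bounds f (or_introl (erefl p1)).
by have /andP[] := L_bounds f (or_intror (erefl (- p0))).
Qed.

Let magn_term f j : mixture S0 S1 f * magnetization S0 S1 f ^+ j.+1 =
  W f * (N f ^+ j.+1 / Z f ^+ j).
Proof.
rewrite /magnetization mixtureSE !stepE -mulrBr -/(N f).
have [W0|W0] := eqVneq (W f) 0; first by rewrite W0 !mul0r.
have Z0 : Z f != 0 by rewrite gt_eqF.
rewrite invfM mulrACA divff // mul1r expr_div_n exprS exprS.
by rewrite -mulrA [Z f * (_ / _)]mulrCA [(Z f * _)^-1]invfM mulVKf.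
Qed.

Let expectation_prod (g : T -> R) :
  \sum_f W f * \prod_k g (f k) = (\sum_t Q t * g t) ^+ d.
Proof.
have cst x : x ^+ d = \prod_(k < d) x :> R by rewrite prodr_const card_ord.
rewrite cst (bigA_distr_bigA (fun (k : 'I_d) t => Q t * g t)).
by apply: eq_bigr => f _; rewrite -big_split.
Qed.

Let expectation_cubic (h : {ffun 'I_d -> T} -> R) (g : T -> R) (c1 c2 c3 z : R) :
  (forall f, h f = \prod_k g (f k)) ->
  (forall t, g t = 1 + c1 * Y t + c2 * Y t ^+ 2 + c3 * Y t ^+ 3) ->
  c2 * magn2 P0 P1 + c3 * magn3 P0 P1 = z ->
  \sum_f W f * h f = (1 + z) ^+ d.
Proof.
move=> hE gE <-; under eq_bigr do rewrite hE.
rewrite expectation_prod; congr (_ ^+ _).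
by under eq_bigr do rewrite gE; rewrite sum_magnetization_cubic.
Qed.

Let u := theta ^+ 2 * magn2 P0 P1.
Let v := theta ^+ 3 * magn3 P0 P1.

Let EAB i j (c1 c2 c3 z : R) :
  (forall y, (1 + theta * p1 * y) ^+ i * (1 + theta * (- p0) * y) ^+ j =
     1 + c1 * y + c2 * y ^+ 2 + c3 * y ^+ 3) ->
  c2 * magn2 P0 P1 + c3 * magn3 P0 P1 = z ->
  \sum_f W f * (A f ^+ i * B f ^+ j) = (1 + z) ^+ d.
Proof.
move=> cE; apply: (expectation_cubic (g := fun t =>
  (1 + theta * p1 * Y t) ^+ i * (1 + theta * (- p0) * Y t) ^+ j) (c1 := c1)) => //.
by move=> f; rewrite big_split !prodrXl.
Qed.

Let E20 : \sum_f W f * (A f ^+ 2 * B f ^+ 0) = (1 + p1 ^+ 2 * u) ^+ d.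
Proof.
apply: (EAB (c1 := 2 * theta * p1) (c2 := theta ^+ 2 * p1 ^+ 2) (c3 := 0)).
  by move=> y; ring.
by rewrite /u; ring.
Qed.
Let E11 : \sum_f W f * (A f ^+ 1 * B f ^+ 1) = (1 + - (p0 * p1) * u) ^+ d.
Proof.
apply: (EAB (c1 := theta * (p1 - p0)) (c2 := - theta ^+ 2 * p0 * p1) (c3 := 0)).
  by move=> y; ring.
by rewrite /u; ring.
Qed.
Let E02 : \sum_f W f * (A f ^+ 0 * B f ^+ 2) = (1 + p0 ^+ 2 * u) ^+ d.
Proof.
apply: (EAB (c1 := - 2 * theta * p0) (c2 := theta ^+ 2 * p0 ^+ 2) (c3 := 0)).
  by move=> y; ring.
by rewrite /u; ring.
Qed.
Let E30 : \sum_f W f * (A f ^+ 3 * B f ^+ 0) =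
  (1 + (3 * p1 ^+ 2 * u + p1 ^+ 3 * v)) ^+ d.
Proof.
apply: (EAB (c1 := 3 * theta * p1) (c2 := 3 * theta ^+ 2 * p1 ^+ 2)
  (c3 := theta ^+ 3 * p1 ^+ 3)).
  by move=> y; ring.
by rewrite /u /v; ring.
Qed.
Let E21 : \sum_f W f * (A f ^+ 2 * B f ^+ 1) =
  (1 + ((p1 ^+ 2 - 2 * p0 * p1) * u - p1 ^+ 2 * p0 * v)) ^+ d.
Proof.
apply: (EAB (c1 := theta * (2 * p1 - p0))
  (c2 := theta ^+ 2 * (p1 ^+ 2 - 2 * p0 * p1)) (c3 := - theta ^+ 3 * p1 ^+ 2 * p0)).
  by move=> y; ring.
by rewrite /u /v; ring.
Qed.
Let E12 : \sum_f W f * (A f ^+ 1 * B f ^+ 2) =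
  (1 + ((p0 ^+ 2 - 2 * p0 * p1) * u + p0 ^+ 2 * p1 * v)) ^+ d.
Proof.
apply: (EAB (c1 := theta * (p1 - 2 * p0))
  (c2 := theta ^+ 2 * (p0 ^+ 2 - 2 * p0 * p1)) (c3 := theta ^+ 3 * p0 ^+ 2 * p1)).
  by move=> y; ring.
by rewrite /u /v; ring.
Qed.
Let E03 : \sum_f W f * (A f ^+ 0 * B f ^+ 3) =
  (1 + (3 * p0 ^+ 2 * u - p0 ^+ 3 * v)) ^+ d.
Proof.
apply: (EAB (c1 := - 3 * theta * p0) (c2 := 3 * theta ^+ 2 * p0 ^+ 2)
  (c3 := - theta ^+ 3 * p0 ^+ 3)).
  by move=> y; ring.
by rewrite /u /v; ring.
Qed.
Let E00 : \sum_f W f = 1.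
Proof.
rewrite (eq_bigr (fun f => W f * \prod_(k < d) 1)) => [|f _].
  rewrite (expectation_prod (fun=> 1)); under eq_bigr do rewrite mulr1.
  by rewrite mixture_sum ?expr1n.
by rewrite big1 ?mulr1.
Qed.
Let E10 : \sum_f W f * (A f ^+ 1 * B f ^+ 0) = 1.
Proof.
rewrite (EAB (c1 := theta * p1) (c2 := 0) (c3 := 0) (z := 0)) ?addr0 ?expr1n //.
  by move=> y; ring.
by rewrite !mul0r addr0.
Qed.
Let E01 : \sum_f W f * (A f ^+ 0 * B f ^+ 1) = 1.
Proof.
rewrite (EAB (c1 := - theta * p0) (c2 := 0) (c3 := 0) (z := 0)) ?addr0 ?expr1n //.
  by move=> y; ring.
by rewrite !mul0r addr0.
Qed.

Let EN2 : \sum_f W f * N f ^+ 2 = moment_N2 d p0 p1 u.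
Proof.
rewrite /moment_N2 -E20 -E11 -E02 mulr_sumr -sumrB -big_split.
by apply: eq_bigr => f _; rewrite /N /=; ring.
Qed.
Let EZ2 : \sum_f W f * (1 - Z f) ^+ 2 = moment_Z2 d p0 p1 u.
Proof.
have -> : \sum_f W f * (1 - Z f) ^+ 2 = \sum_f W f
   + p0 ^+ 2 * (\sum_f W f * (A f ^+ 2 * B f ^+ 0))
   + 2 * p0 * p1 * (\sum_f W f * (A f ^+ 1 * B f ^+ 1))
   + p1 ^+ 2 * (\sum_f W f * (A f ^+ 0 * B f ^+ 2))
   - 2 * p0 * (\sum_f W f * (A f ^+ 1 * B f ^+ 0))
   - 2 * p1 * (\sum_f W f * (A f ^+ 0 * B f ^+ 1)).
  rewrite !mulr_sumr -!big_split -!sumrB.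
  by apply: eq_bigr => f _; rewrite /Z /=; ring.
by rewrite E00 E20 E11 E02 E10 E01 /moment_Z2 p1E; ring.
Qed.
Let EN2Z : \sum_f W f * (N f ^+ 2 * Z f) = moment_N2Z d p0 p1 u v.
Proof.
rewrite /moment_N2Z -E30 -E21 -E12 -E03 !mulr_sumr -!big_split.
by apply: eq_bigr => f _; rewrite /N /Z /=; ring.
Qed.
Let EN3 : \sum_f W f * N f ^+ 3 = moment_N3 d p0 p1 u v.
Proof.
rewrite /moment_N3 -E30 -E21 -E12 -E03 !mulr_sumr -!sumrB -!big_split -sumrB.
by apply: eq_bigr => f _; rewrite /N /=; ring.
Qed.

(** The difference of N^2 / Z and N^2 (2 - Z) is N^2 (1 - Z)^2 / Z. *)
Lemma magn2_step_ge :
  2 * moment_N2 d p0 p1 u - moment_N2Z d p0 p1 u v <= magn2 S0 S1.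
Proof.
rewrite -EN2 -EN2Z mulr_sumr -sumrB ler_sum // => f _.
rewrite (magn_term f 1) mulrCA -mulrBr ler_wpM2l // -subr_ge0.
have Z0 : Z f != 0 by rewrite gt_eqF.
have -> : N f ^+ 2 / Z f ^+ 1 - (2 * N f ^+ 2 - N f ^+ 2 * Z f) =
  N f ^+ 2 * (1 - Z f) ^+ 2 / Z f by field.
by rewrite divr_ge0 ?(ltW (Z_gt0 f)) // (mulr_ge0 (sqr_ge0 _) (sqr_ge0 _)).
Qed.

(** A cruder bound, from Z <= (1 + m)^d, that is useful when u is not small:
    its left-hand side stays above u / 2, while the polynomial of
    [magn2_step_ge] may be negative. *)
Lemma magn2_step_ge_linear :
  moment_N2 d p0 p1 u <= (1 + m) ^+ d * magn2 S0 S1.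
Proof.
rewrite -EN2 mulr_sumr ler_sum // => f _.
rewrite (magn_term f 1) [leRHS]mulrCA ler_wpM2l // mulrA ler_pdivlMr ?expr1 //.
by have /andP[_ h] := Z_bounds f; rewrite mulrC ler_wpM2r ?sqr_ge0.
Qed.

(** The third moment after one step is E (N^3 / Z^2).  Its distance to E N^3 is
    at most a constant times E |N (1 - Z)|, as N and N / Z are bounded and Z is
    bounded below.  The inequality |N (1 - Z)| <= t N^2 + (1 - Z)^2 / t, with t
    free, replaces the bound of order x^(3/2) that Cauchy-Schwarz would give. *)
Lemma magn3_step_le (t : R) : 0 < t ->
  `|magn3 S0 S1 - moment_N3 d p0 p1 u v| <=
  m ^+ 2 * (1 + m) ^+ d * (1 + 4 ^+ d) *
    (t * moment_N2 d p0 p1 u + t^-1 * moment_Z2 d p0 p1 u).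
Proof.
move=> t0; rewrite -EN3 -EN2 -EZ2 -sumrB (le_trans (ler_norm_sum _ _ _)) //.
rewrite !mulr_sumr -big_split mulr_sumr ler_sum // => f _ /=.
rewrite (magn_term f 2) -mulrBr normrM (ger0_norm (W_ge0 f)).
rewrite [t * _]mulrCA [t^-1 * _]mulrCA -mulrDr [leRHS]mulrCA ler_wpM2l //.
have Z0 : Z f != 0 by rewrite gt_eqF.
have -> : N f ^+ 3 / Z f ^+ 2 - N f ^+ 3 =
  (N f / Z f) * N f * (1 + (Z f)^-1) * (N f * (1 - Z f)) by field.
have /andP[Zlo Zhi] := Z_bounds f.
rewrite 3!normrM expr2 -!mulrA.
have h1 : `|N f / Z f| <= m.
  by rewrite normrM normfV (gtr0_norm (Z_gt0 f)) ler_pdivrMr // N_le.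
have h2 : `|N f| <= m * (1 + m) ^+ d.
  by rewrite (le_trans (N_le f)) // ler_wpM2l // ltW.
have h3 : `|1 + (Z f)^-1| <= 1 + 4 ^+ d.
  rewrite ger0_norm ?addr_ge0 ?invr_ge0 ?(ltW (Z_gt0 f)) // lerD2l.
  by rewrite -[4]invrK exprVn lef_pV2 ?posrE ?exprn_gt0 ?invr_gt0.
have h4 : `|N f * (1 - Z f)| <= t * N f ^+ 2 + t^-1 * (1 - Z f) ^+ 2.
  have ti : 0 < t^-1 by rewrite invr_gt0.
  have p : 0 <= t * (N f - t^-1 * (1 - Z f)) ^+ 2 by rewrite mulr_ge0 ?sqr_ge0 // ltW.
  have p' : 0 <= t * (N f + t^-1 * (1 - Z f)) ^+ 2 by rewrite mulr_ge0 ?sqr_ge0 // ltW.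
  have e1 : t * (N f - t^-1 * (1 - Z f)) ^+ 2 = t * N f ^+ 2 - 2 * (N f * (1 - Z f))
     + t^-1 * (1 - Z f) ^+ 2 by field; rewrite gt_eqF.
  have e2 : t * (N f + t^-1 * (1 - Z f)) ^+ 2 = t * N f ^+ 2 + 2 * (N f * (1 - Z f))
     + t^-1 * (1 - Z f) ^+ 2 by field; rewrite gt_eqF.
  have n1 : 0 <= t * N f ^+ 2 by rewrite mulr_ge0 ?sqr_ge0 // ltW.
  have n2 : 0 <= t^-1 * (1 - Z f) ^+ 2 by rewrite mulr_ge0 ?sqr_ge0 // ltW.
  by rewrite ler_norml; apply/andP; split; lra.
rewrite (le_trans (ler_pM _ _ h1 (ler_pM _ _ h2 (ler_pM _ _ h3 h4)))) ?mulr_ge0 //.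
by rewrite !mulrA.
Qed.

End Step.
End Magnetization.

(** * Uniform inequalities for one generation *)

(** The hypotheses of [magnetization_persists], with constants that depend on
    neither theta nor the level of the tree.  Since d theta^2 lies between 1/2
    and 1, the variables u and x are comparable; and since d theta^3 is at most
    theta <= 3/4, the third moment contracts. *)
Lemma broadcast_step_dynamics (R : realFieldType) (p0 p1 : R) (d : nat) :
  0 < p0 -> 0 < p1 -> p0 + p1 = 1 -> 1 / 3 < (p1 - p0) ^+ 2 -> (2 <= d)%N ->
  exists a b C c, exists K : R -> R,
  [/\ [/\ 0 < a, 0 <= b, 0 <= C & 0 < c], forall t, 0 < t -> 0 <= K t &
    forall (theta : R) (T : finType) (P0 P1 : T -> R),
    0 <= theta -> theta <= 3 / 4 ->
    1 / 2 <= d%:R * theta ^+ 2 -> d%:R * theta ^+ 2 <= 1 ->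
    (forall t, 0 <= P0 t) -> (forall t, 0 <= P1 t) ->
    \sum_t P0 t = 1 -> \sum_t P1 t = 1 ->
    let x := magn2 p0 p1 P0 P1 in let w := magn3 p0 p1 P0 P1 in
    let S0 := @broadcast_step R p0 p1 T d theta p1 P0 P1 in
    let S1 := @broadcast_step R p0 p1 T d theta (- p0) P0 P1 in
    let x' := magn2 p0 p1 S0 S1 in
    [/\ d%:R * theta ^+ 2 * x + a * x ^+ 2 - b * x * `|w| - C * x ^+ 3 <= x',
        c * x <= x' &
        forall t, 0 < t ->
          `|magn3 p0 p1 S0 S1| <= 3 / 4 * `|w| + t * x + K t * x ^+ 2]].
Proof.
move=> p0_gt0 p1_gt0 p01 asym d2.
have del : `|p1 - p0| <= 1 by rewrite ler_norml; apply/andP; split; lra.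
set m := (p0 * p1)^-1.
have m0 : 0 < m by rewrite invr_gt0 mulr_gt0.
have p1E : p1 = 1 - p0 by rewrite -p01 addrAC subrr add0r.
have m2 : 0 <= 2 * m by rewrite mulr_ge0 // ltW.
have [C C0 HC] := moments_expansion d (ltW p0_gt0) (ltW p1_gt0) p01 (ltW m0) m2.
pose g := (p1 - p0) ^+ 2 - 2 * p0 * p1.
(* 2 g = 3 (p1 - p0)^2 - 1. *)
have g0 : 0 < g by rewrite /g; move: asym; rewrite p1E; nra.
pose Bd : R := 'C(d, 2)%:R.
have Bd0 : 0 < Bd by rewrite ltr0n bin_gt0.
have D0 : 0 < d%:R :> R by rewrite ltr0n (leq_trans _ d2).
pose kap := m ^+ 2 * (1 + m) ^+ d * (1 + 4 ^+ d).
have m1 : 0 < 1 + m by rewrite addr_gt0.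
have kap0 : 0 < kap.
  by rewrite !mulr_gt0 ?exprn_gt0 // ltr_pwDl // exprn_ge0.
pose h := (2 * d%:R)^-1 : R.
have h0 : 0 < h by rewrite invr_gt0 mulr_gt0.
pose M := (1 + m) ^+ d.
have M0 : 0 < M by rewrite exprn_gt0.
exists (Bd * g * h ^+ 2), (Bd * (4 + m)), C, (h / 2 / M).
exists (fun t => C * (t + kap ^+ 2 / t + 1)).
split.
- split=> //; rewrite ?divr_gt0 // ?mulr_gt0 ?exprn_gt0 //.
  by rewrite mulr_ge0 ?addr_ge0 // ltW.
- by move=> t t0; rewrite mulr_ge0 // !addr_ge0 ?divr_ge0 ?exprn_ge0 // ltW.
move=> th T P0 P1 th0 th34 hlo hhi P0_ge0 P1_ge0 P0_sum P1_sum x w S0 S1 x'.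
have st1 := magn2_step_ge p0_gt0 p1_gt0 p01 d P0_ge0 P1_ge0 P0_sum P1_sum th0 th34.
have st2 := magn2_step_ge_linear p0_gt0 p1_gt0 p01 d P0_ge0 P1_ge0 P0_sum P1_sum th0 th34.
have st3 := magn3_step_le p0_gt0 p1_gt0 p01 d P0_ge0 P1_ge0 P0_sum P1_sum th0 th34.
rewrite -/x -/w -/S0 -/S1 -/x' -/m -/kap -/M in st1 st2 st3.
have x0 : 0 <= x by apply: magn2_ge0.
have x2m : x <= 2 * m by apply: magn2_le.
have wx : `|w| <= m * x by apply: normr_magn3_le.
have th1 : th <= 1 by rewrite (le_trans th34) // ler_pdivrMr // mul1r ler_nat.
have th2 : 0 <= th ^+ 2 <= 1 by rewrite exprn_ge0 // exprn_ile1.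
have /andP[th2_0 th2_1] := th2.
move: (st1) (st2) (st3).
set u := th ^+ 2 * x; set v := th ^+ 3 * w => {}st1 {}st2 {}st3.
have u0 : 0 <= u by rewrite mulr_ge0.
have ux : u <= x by rewrite ler_piMl.
have um : u <= 2 * m := le_trans ux x2m.
have vw2 : `|v| = th ^+ 2 * (th * `|w|).
  by rewrite /v normrM ger0_norm ?exprn_ge0 // exprSr mulrA.
have vu : `|v| <= m * u.
  by rewrite vw2 /u [leRHS]mulrCA ler_wpM2l // (le_trans _ wx) // ler_piMl.
have vw : `|v| <= `|w|.
  by rewrite vw2 mulrA ler_piMl // mulr_ile1.
have [e1 e2 e3 e4] := HC u v u0 um vu.
have hth : h <= th ^+ 2.
  rewrite /h -(ler_pM2l D0) (le_trans _ hlo) // invfM mulrCA divff ?mulr1 ?gt_eqF //.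
  by rewrite mul1r.
have hxu : h * x <= u by rewrite ler_wpM2r.
have u2 : u ^+ 2 <= x ^+ 2 by rewrite lerXn2r ?nnegrE.
have u3 : u ^+ 3 <= x ^+ 3 by rewrite lerXn2r ?nnegrE.
have Cu2 := ler_wpM2l C0 u2.
have du : d%:R * u = d%:R * th ^+ 2 * x by rewrite mulrA.
have p0_le1 : p0 <= 1 by rewrite -p01 lerDl ltW.
have p1_le1 : p1 <= 1 by rewrite -p01 lerDr ltW.
have q0 : 0 < p0 * p1 by rewrite mulr_gt0.
have q1 : p0 * p1 <= 1 by rewrite mulr_ile1 // ltW.
clearbody u v; split.
- apply: le_trans st1; rewrite -du.
  have k1 : Bd * g * h ^+ 2 * x ^+ 2 <= Bd * g * u ^+ 2.
    rewrite -mulrA ler_wpM2l ?mulr_ge0 ?(ltW Bd0) ?(ltW g0) // -exprMn.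
    by rewrite lerXn2r ?nnegrE ?mulr_ge0 // ltW.
  have k2 : p0 * p1 * (p1 - p0) * u * v <= u * `|v|.
    rewrite (le_trans (ler_norm _)) // !normrM (ger0_norm u0).
    rewrite -[leRHS]mul1r -mulrA ler_wpM2r ?mulr_ge0 //.
    by rewrite mulr_ile1 ?mulr_ge0 // mulr_ile1 // ger0_norm // ltW.
  have k3 : p0 * p1 * (p1 - p0) ^+ 2 * v ^+ 2 <= m * (u * `|v|).
    rewrite -(real_normK (num_real v)) -(real_normK (num_real (p1 - p0))).
    rewrite (le_trans (_ : _ <= `|v| ^+ 2)) //.
      by rewrite ler_piMl ?exprn_ge0 // mulr_ile1 ?exprn_ge0 // ?exprn_ile1 // ltW.
    by rewrite mulrA expr2 ler_wpM2r.
  have k4 : u * `|v| <= x * `|w| by rewrite ler_pM.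
  have k5 : Bd * (4 * p0 * p1 * (p1 - p0) * u * v
      + p0 * p1 * (p1 - p0) ^+ 2 * v ^+ 2) <= Bd * (4 + m) * x * `|w|.
    rewrite -!mulrA ler_wpM2l ?(ltW Bd0) //.
    apply: (@le_trans _ _ ((4 + m) * (u * `|v|))); last first.
      by rewrite ler_wpM2l // addr_ge0 // ltW.
    by have := k2; have := k3; lra.
  have k6 := ler_wpM2l C0 u3.
  move: e4; rewrite -/g -/Bd ler_norml => /andP[e4 _].
  by lra.
- rewrite -(ler_pM2l M0) (le_trans _ st2) //.
  have -> : M * (h / 2 / M * x) = (h * x) / 2 by field; rewrite gt_eqF.
  have b1 (s : R) : 0 <= s -> 1 + s <= (1 + s) ^+ d.
    by move=> s0; rewrite ler_eXnr // ?lerDl // (leq_trans _ d2).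
  have b2 : (1 + - (p0 * p1) * u) ^+ d <= 1.
    have qu : p0 * p1 * u <= 2.
      by have := ler_wpM2l (ltW q0) um; rewrite [leRHS]mulrCA divff ?gt_eqF // mulr1.
    rewrite (le_trans (ler_norm _)) // normrX exprn_ile1 // ler_norml.
    have := mulr_ge0 (ltW q0) u0.
    by move=> qu0; apply/andP; split; lra.
  rewrite /moment_N2.
  have b3 := b1 (p1 ^+ 2 * u) (mulr_ge0 (sqr_ge0 _) u0).
  have b4 := b1 (p0 ^+ 2 * u) (mulr_ge0 (sqr_ge0 _) u0).
  have b5 : 1 / 2 * u <= (p0 ^+ 2 + p1 ^+ 2) * u.
    by rewrite ler_wpM2r // p1E; have := sqr_ge0 (2 * p0 - 1); lra.
  by lra.
(* The constant kap of the bound on the third moment is absorbed in t. *)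
- move=> t t0; have kt0 : 0 < t / kap by rewrite divr_gt0.
  have := st3 _ kt0; set N3 := moment_N3 _ _ _ _ _; set N2 := moment_N2 _ _ _ _.
  set Z2 := moment_Z2 _ _ _ _ => s3.
  have n2 : N2 <= x + C * x ^+ 2.
    have := ler_wpM2r x0 hhi; rewrite mul1r -du.
    by move: e1; rewrite -/N2 ler_norml => /andP[_ e1]; lra.
  have z2 : Z2 <= C * x ^+ 2 by rewrite (le_trans (ler_norm _)) // (le_trans e2).
  have n3 : `|N3| <= 3 / 4 * `|w| + C * x ^+ 2.
    have -> : N3 = (N3 - d%:R * v) + d%:R * v by rewrite subrK.
    rewrite (le_trans (ler_normD _ _)) // addrC lerD //; last exact: le_trans e3 _.
    rewrite normrM vw2 (ger0_norm (ltW D0)) !mulrA ler_wpM2r //.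
    by rewrite -(mulrA d%:R th th) -expr2 (le_trans _ th34) // ler_piMl.
  have s4 : kap * (t / kap * N2 + (t / kap)^-1 * Z2) <=
     t * (x + C * x ^+ 2) + kap ^+ 2 / t * (C * x ^+ 2).
    have -> : kap * (t / kap * N2 + (t / kap)^-1 * Z2) = t * N2 + kap ^+ 2 / t * Z2.
      by field; rewrite !gt_eqF.
    apply: lerD; first by rewrite ler_wpM2l // ltW.
    by rewrite ler_wpM2l // divr_ge0 ?(ltW t0) // sqr_ge0.
  have := ler_normD (magn3 p0 p1 S0 S1 - N3) N3; rewrite subrK => /le_trans.
  apply; rewrite (le_trans (lerD (le_trans s3 s4) n3)) //.
  by rewrite le_eqVlt; apply/orP; left; apply/eqP; ring.
Qed.

(** * Recursion along the tree *)

Section Tree.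
Variables (R : comNzRingType) (d : nat).
Local Notation config n := {ffun n.-bseq 'I_d -> 'I_2}.

Lemma insub_bseq_val n (v : n.-bseq 'I_d) : insub_bseq n v = v.
Proof. by rewrite /insub_bseq valKd. Qed.

(** A word is empty or consists of a first letter and a shorter word. *)
Lemma big_bseqS n (F : n.+1.-bseq 'I_d -> R) :
  \prod_u F u = F [bseq] * \prod_(c < d) \prod_(v : n.-bseq 'I_d) F (cons_bseq c v).
Proof.
rewrite (bigD1 [bseq]) //=; congr (_ * _).
rewrite pair_bigA /=.
(* The inverse of the reindexing takes values in an option type, as there is no
   default letter when d = 0. *)
pose g (u : n.+1.-bseq 'I_d) : option ('I_d * n.-bseq 'I_d) :=
  if val u is c :: v then Some (c, insub_bseq n v) else None.
rewrite (reindex_omap (fun cv => cons_bseq cv.1 cv.2) g) => [|[[|c v] uP] //=].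
  by apply: eq_bigl => -[c v] /=; rewrite /g /= insub_bseq_val eqxx.
move=> _; congr Some; apply: val_inj => /=.
by rewrite /insub_bseq val_insubd; move: uP => /= uP; rewrite ltnS in uP; rewrite uP.
Qed.

(** A configuration on the tree of depth n.+1 amounts to the spin of the root and
    a configuration on each of the d subtrees rooted at its children. *)
Definition join_spins n (x : 'I_2 * {ffun 'I_d -> config n}) :
    config n.+1 :=
  [ffun u => if val u is c :: v then x.2 c (insub_bseq n v) else x.1].

Lemma join_spins_bij n : bijective (@join_spins n).
Proof.
exists (fun s : config n.+1 =>
  (s [bseq], [ffun c => [ffun v => s (cons_bseq c v)]])).
  move=> [i F]; rewrite /join_spins ffunE /=; congr (_, _).
  by apply/ffunP => c; rewrite ffunE; apply/ffunP => v; rewrite !ffunE /= insub_bseq_val.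
move=> s; apply/ffunP => -[[|c v] uP]; rewrite ffunE /=.
  by congr (s _); apply: val_inj.
rewrite !ffunE; congr (s _); apply: val_inj => /=.
by rewrite /insub_bseq val_insubd; move: uP => /= uP; rewrite ltnS in uP; rewrite uP.
Qed.

Definition split_spins n (t : {ffun n.+1.-tuple 'I_d -> 'I_2}) :
    {ffun 'I_d -> {ffun n.-tuple 'I_d -> 'I_2}} :=
  [ffun c => [ffun v => t (cons_tuple c v)]].

Lemma split_spins_bij n : bijective (@split_spins n).
Proof.
exists (fun F : {ffun 'I_d -> {ffun n.-tuple 'I_d -> 'I_2}} =>
  [ffun v : n.+1.-tuple 'I_d => F (thead v) (behead_tuple v)]).
  move=> t; apply/ffunP => v; rewrite !ffunE; congr (t _).
  by rewrite [v in RHS]tuple_eta; apply: val_inj.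
move=> F; apply/ffunP => c; apply/ffunP => v; rewrite !ffunE theadE.
by congr (F _ _); apply: val_inj.
Qed.

Lemma level_join_spins n (x : 'I_2 * {ffun 'I_d -> config n}) t :
  (level_spins (join_spins x) == t) =
  [forall c, level_spins (x.2 c) == split_spins t c].
Proof.
apply/eqP/forallP => [<- c|h].
  apply/eqP/ffunP => v; rewrite !ffunE /=; congr (x.2 c _).
  by rewrite (insub_bseq_val (bseq_of_tuple v)).
apply: (bij_inj (@split_spins_bij n)); apply/ffunP => c.
rewrite -(eqP (h c)); apply/ffunP => v; rewrite !ffunE /=; congr (x.2 c _).
by rewrite (insub_bseq_val (bseq_of_tuple v)).
Qed.

Variable M : 'M[R]_2.

(** The factor of [broadcast_law] that remains after removal of the
    probability of the spin of the root. *)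
Definition transition_weight n (s : config n) : R :=
  \prod_(u : n.-bseq 'I_d | (size u < n)%N) \prod_(c < d)
     M (s u) (s (insub_bseq n (rcons u c))).

Lemma transition_weight_join n i (F : {ffun 'I_d -> config n}) :
  transition_weight (join_spins (i, F)) =
  \prod_(c < d) (M i (F c [bseq]) * transition_weight (F c)).
Proof.
rewrite /transition_weight big_mkcond big_bseqS /= big_split /=; congr (_ * _).
  apply: eq_bigr => c _; rewrite !ffunE /= val_insubd /=; congr (M i (F c _)).
  by apply: val_inj; rewrite val_insubd.
apply: eq_bigr => c _; rewrite [RHS]big_mkcond; apply: eq_bigr => v _.
rewrite /= ltnS; case: ifP => // vn; apply: eq_bigr => c' _.
rewrite !ffunE /= insub_bseq_val val_insubd /= size_rcons ltnS vn /=.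
by [].
Qed.

Definition cond_law n (i : 'I_2) (t : {ffun n.-tuple 'I_d -> 'I_2}) : R :=
  \sum_(s | (level_spins s == t) && (s [bseq] == i)) transition_weight s.

Lemma cond_law0 (i : 'I_2) t : cond_law i t = (t [tuple] == i)%:R.
Proof.
have bseq_nil (u : 0.-bseq 'I_d) : u = [bseq].
  by apply: val_inj; case: u => -[].
have tup_nil (v : 0.-tuple 'I_d) : v = [tuple] by rewrite (tuple0 v).
have lev (s : config 0) : level_spins s == t = (s [bseq] == t [tuple]).
  apply/eqP/eqP => [<-|st]; first by rewrite ffunE; congr (s _); apply: val_inj.
  by apply/ffunP => v; rewrite ffunE (tup_nil v) -st; congr (s _); apply: val_inj.
rewrite /cond_law; under eq_bigl do rewrite lev.
have [ti|ti] := eqVneq (t [tuple]) i; last first.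
  rewrite big_pred0 // => s; apply/negP => /andP[/eqP st /eqP si].
  by rewrite -st si eqxx in ti.
rewrite (big_pred1 [ffun=> i]) => [|s]; last first.
  rewrite ti andbb /=; apply/eqP/eqP => [si|->]; last by rewrite ffunE.
  by apply/ffunP => u; rewrite ffunE (bseq_nil u).
by rewrite /transition_weight big_pred0.
Qed.

(** Given the spin of the root, the subtrees of its children are independent. *)
Lemma cond_lawS n i (t : {ffun n.+1.-tuple 'I_d -> 'I_2}) :
  cond_law i t = \prod_(c < d) \sum_j M i j * cond_law j (split_spins t c).
Proof.
rewrite /cond_law (reindex _ (onW_bij _ (@join_spins_bij n))) /=.
under eq_bigl do rewrite level_join_spins ffunE /=.
rewrite (eq_bigl (fun x : 'I_2 * {ffun 'I_d -> config n} =>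
  (x.1 == i) && [forall c, level_spins (x.2 c) == split_spins t c])); last first.
  by move=> x; rewrite andbC.
rewrite -(pair_big_dep (fun j => j == i) (fun _ (F : {ffun 'I_d -> config n}) =>
   [forall c, level_spins (F c) == split_spins t c])
   (fun j F => transition_weight (join_spins (j, F)))) /= big_pred1_eq.
under eq_bigr do rewrite transition_weight_join.
under [RHS]eq_bigr => c _.
  rewrite (eq_bigr (fun j => \sum_(s | (level_spins s == split_spins t c) && (s [bseq] == j))
      M i (s [bseq]) * transition_weight s)); last first.
    by move=> j _; rewrite mulr_sumr; apply: eq_bigr => s /andP[_ /eqP ->].
  rewrite -(partition_big (fun s : config n => s [bseq]) predT) //.
  over.
by rewrite bigA_distr_big_dep /=; apply: eq_bigl => F; apply/forallP/familyP.
Qed.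

Lemma sum_cond_law n i : (forall k, \sum_j M k j = 1) ->
  \sum_(t : {ffun n.-tuple 'I_d -> 'I_2}) cond_law i t = 1.
Proof.
move=> M1; elim: n i => [|n IH] i.
  rewrite (bigD1 [ffun=> i]) //= cond_law0 ffunE eqxx big1 ?addr0 // => t ti.
  rewrite cond_law0; case: eqP => // ti'; case/eqP: ti.
  by apply/ffunP => v; rewrite ffunE (tuple0 v).
under eq_bigr do rewrite cond_lawS.
have [h hK Kh] := split_spins_bij n.
rewrite (reindex h) /=; last by exists (@split_spins n) => x _; [rewrite Kh|rewrite hK].
under eq_bigr do rewrite Kh.
rewrite -(bigA_distr_bigA (fun (c : 'I_d) t => \sum_j M i j * cond_law j t)).
rewrite big1 // => c _; rewrite exchange_big /=.
by rewrite -[RHS](M1 i); apply: eq_bigr => j _; rewrite -mulr_sumr IH mulr1.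
Qed.

End Tree.

Lemma level_law_cond_law (R : realType) (d : nat) (p : 'rV[R]_2) (M : 'M[R]_2)
    (i : 'I_2) (n : nat) t : p 0 i != 0 -> (forall k, \sum_j M k j = 1) ->
  @level_law R d p M i n t = cond_law M i t.
Proof.
move=> pi0 M1.
have num E : @broadcast_pr R d p M n (fun s => E s && (s [bseq] == i)) =
    p 0 i * \sum_(s | E s && (s [bseq] == i)) transition_weight M s.
  by rewrite mulr_sumr; apply: eq_bigr => s /andP[_ /eqP si]; rewrite /broadcast_law si.
have den : broadcast_pr p M (fun s : {ffun n.-bseq 'I_d -> 'I_2} => s [bseq] == i) = p 0 i.
  rewrite [LHS](num predT) -[RHS]mulr1 -(sum_cond_law d n i M1); congr (_ * _).
  rewrite (partition_big (@level_spins d n) predT) //=.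
  by apply: eq_bigr => u _; apply: eq_bigl => s; rewrite andbC.
by rewrite /level_law den num mulrAC divff // mul1r.
Qed.

(** * Reconstruction below the Kesten-Stigum bound *)

Lemma sum_I2 (R : nmodType) (F : 'I_2 -> R) : \sum_j F j = F 0 + F 1.
Proof.
rewrite big_ord_recl big_ord1; congr (F _ + F _); exact: val_inj.
Qed.

Lemma case_I2 (i : 'I_2) : i = 0 \/ i = 1.
Proof. by case: i => -[|[|//]] h; [left|right]; apply: val_inj. Qed.

Section Channel.
Variables (R : realType) (p : 'rV[R]_2) (theta : R).
Hypothesis p_sum : p 0 0 + p 0 1 = 1.

(** For theta in [0, 1] the channel copies the spin with probability theta and
    otherwise draws it afresh from p. *)
Lemma channel_ofE i j :
  channel_of p theta i j = theta * (i == j)%:R + (1 - theta) * p 0 j.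
Proof.
have p0E : p 0 0 = 1 - p 0 1 by rewrite -p_sum addrK.
by rewrite !mxE /Delta_of; case: (case_I2 i) (case_I2 j) => -> [] -> /=;
  rewrite p0E; field.
Qed.

Lemma channel_of_gt0 i j : 0 < theta -> theta < 1 -> (forall k, 0 < p 0 k) ->
  0 < channel_of p theta i j.
Proof.
move=> t0 t1 p0; rewrite channel_ofE ltr_wpDl //.
  by rewrite mulr_ge0 // ltW.
by rewrite mulr_gt0 // subr_gt0.
Qed.

Lemma admissible_pos : 0 < theta -> theta < 1 -> (forall k, 0 < p 0 k) ->
  admissible p theta.
Proof.
move=> t0 t1 p0; have M0 i j := channel_of_gt0 i j t0 t1 p0.
have p0E : p 0 0 = 1 - p 0 1 by rewrite -p_sum addrK.
have [p00 p01] := (p0 0, p0 1).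
split.
- have t1' : 0 <= 1 - theta by rewrite subr_ge0 ltW.
  rewrite /Delta_of normrM (gtr0_norm t0) (ger0_norm t1').
  have d1 : `|p 0 1 - p 0 0| <= 1 by rewrite ler_norml; apply/andP; split; lra.
  by have := ler_wpM2l t1' d1; lra.
- by move=> i j; exists 1%N; rewrite expr1.
by move=> i q /(_ 1%N isT); rewrite expr1 => /(_ (M0 i i)); rewrite dvdn1 => /eqP.
Qed.

(** The vector (p 0 1, - p 0 0) is an eigenvector of the channel for the
    eigenvalue theta. *)
Lemma channel_of_mean i (P : 'I_2 -> R) :
  \sum_j channel_of p theta i j * P j =
  p 0 0 * P 0 + p 0 1 * P 1
  + theta * (if i == 0 then p 0 1 else - p 0 0) * (P 0 - P 1).
Proof.
have p0E : p 0 0 = 1 - p 0 1 by rewrite -p_sum addrK.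
by rewrite sum_I2 !channel_ofE; case: (case_I2 i) => -> /=; rewrite p0E; ring.
Qed.
End Channel.

Section Magn.
Variables (R : realFieldType) (p0 p1 : R).
Lemma magn_reindex (S T : finType) (h : S -> T) (P0 P1 : T -> R) : bijective h ->
  magn2 p0 p1 (P0 \o h) (P1 \o h) = magn2 p0 p1 P0 P1 /\
  magn3 p0 p1 (P0 \o h) (P1 \o h) = magn3 p0 p1 P0 P1.
Proof.
by move=> hb; rewrite /magn2 /magn3; split; rewrite [RHS](reindex h) //; apply: onW_bij.
Qed.
End Magn.

Lemma limn_esup_gt0 (R : realType) (u : nat -> R) (c : R) : 0 < c ->
  (forall n, c <= u n) -> (0 < limn_esup (fun n => (u n)%:E))%E.
Proof.
move=> c0 cu; apply: (@lt_le_trans _ _ c%:E); first by rewrite lte_fin.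
rewrite limn_esup_lim; apply: lime_ge; first exact: is_cvg_esups.
near=> n; apply: (@le_trans _ _ (u n)%:E); first by rewrite lee_fin.
by apply: ereal_sup_ubound; exists n => //=.
Unshelve. all: by end_near. Qed.

Theorem theoremI1 (R : realType) (p : 'rV[R]_2)
    (p_gt0 : forall i : 'I_2, 0 < p 0 i)
    (p_sum : p 0 0 + p 0 1 = 1)
    (p_asym : 1 / 3 < (p 0 1 - p 0 0) ^+ 2)
    (d : nat) (d_ge2 : (2 <= d)%N) :
  ~ Kesten_Stigum_tight d p /\
  exists theta : R,
    [/\ admissible p theta,
        d%:R * theta ^+ 2 < 1 &
        reconstruction_solvable d p (channel_of p theta)].
Proof.
suff [theta [adm sub sol]] : exists theta : R,
    [/\ admissible p theta,
        d%:R * theta ^+ 2 < 1 &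
        reconstruction_solvable d p (channel_of p theta)].
  by split; [move=> /(_ theta adm sub)|exists theta].
have [a [b [C [c [K [[a0 b0 C0 c0] K0 step]]]]]] :=
  broadcast_step_dynamics (p_gt0 0) (p_gt0 1) p_sum p_asym d_ge2.
have q0 : 0 < p 0 0 * p 0 1 by rewrite mulr_gt0.
have m0 : 0 <= (p 0 0 * p 0 1)^-1 by rewrite invr_ge0 ltW.
have [e e0 [xmin xmin0 persist]] := magnetization_persists a0 b0 C0 c0 m0 K0.
have D0 : 0 < d%:R :> R by rewrite ltr0n (leq_trans _ d_ge2).
(* The value of d theta^2: below 1, at least 1 / 2, and within e of 1. *)
pose l := Num.max (1 - e) (1 / 2) : R.
have [el hl l1] : [/\ 1 - e <= l, 1 / 2 <= l & l < 1].
  rewrite /l !le_max !lexx orbT gt_max; split=> //.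
  by apply/andP; split; lra.
have l0 : 0 < l by apply: lt_le_trans hl.
pose theta := Num.sqrt (l / d%:R).
have th2 : theta ^+ 2 = l / d%:R by rewrite sqr_sqrtr // divr_ge0 // ltW.
have th0 : 0 < theta by rewrite sqrtr_gt0 divr_gt0.
have dth : d%:R * theta ^+ 2 = l by rewrite th2 mulrCA divff ?mulr1 // gt_eqF.
have th34 : theta <= 3 / 4.
  have d2 : 2 <= d%:R :> R by rewrite ler_nat.
  have h : 2 * theta ^+ 2 <= 1.
    by rewrite (le_trans _ (ltW l1)) // -dth ler_wpM2r // exprn_ge0 // ltW.
  by rewrite -(@ler_pXn2r _ 2) ?nnegrE ?(ltW th0) //; lra.
have th1 : theta < 1 by lra.
exists theta; split; rewrite ?dth //.
  exact: admissible_pos.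
pose M := channel_of p theta.
have M0 i j : 0 <= M i j by apply/ltW/channel_of_gt0.
have M1 := channel_of_stochastic p theta.
pose P n i (t : {ffun n.-tuple 'I_d -> 'I_2}) := cond_law M i t.
have P_ge0 n i t : 0 <= P n i t.
  by rewrite sumr_ge0 // => s _; rewrite !prodr_ge0 // => ? _; rewrite prodr_ge0.
have P_sum n i : \sum_t P n i t = 1 by apply: sum_cond_law.
pose x n := magn2 (p 0 0) (p 0 1) (P n 0) (P n 1).
pose w n := magn3 (p 0 0) (p 0 1) (P n 0) (P n 1).
have PS n i t : P n.+1 i t = broadcast_step (p 0 0) (p 0 1) theta
    (if i == 0 then p 0 1 else - p 0 0) (P n 0) (P n 1) (split_spins t).
  rewrite /P cond_lawS; apply: eq_bigr => k _.
  by rewrite (channel_of_mean _ p_sum i (fun j => cond_law M j (split_spins t k))).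
have stepn n := step theta _ (P n 0) (P n 1) (ltW th0) th34
  (eq_ind_r (fun z => 1 / 2 <= z) hl dth) (eq_ind_r (fun z => z <= 1) (ltW l1) dth)
  (P_ge0 n 0) (P_ge0 n 1) (P_sum n 0) (P_sum n 1).
pose S n i := @broadcast_step R (p 0 0) (p 0 1) _ d theta i (P n 0) (P n 1).
have PSn n : P n.+1 0 = S n (p 0 1) \o @split_spins d n /\
             P n.+1 1 = S n (- p 0 0) \o @split_spins d n.
  by split; apply/funext => t; rewrite PS.
have xS n : x n.+1 = magn2 (p 0 0) (p 0 1) (S n (p 0 1)) (S n (- p 0 0)).
  rewrite /x; have [-> ->] := PSn n.
  exact: (magn_reindex _ _ _ _ (@split_spins_bij d n)).1.
have wS n : w n.+1 = magn3 (p 0 0) (p 0 1) (S n (p 0 1)) (S n (- p 0 0)).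
  rewrite /w; have [-> ->] := PSn n.
  exact: (magn_reindex _ _ _ _ (@split_spins_bij d n)).2.
have x0 : 1 <= x 0%N.
  have p00 := p_gt0 0.
  (* At level 0 the spin 0 alone contributes 1 / p 0 0 >= 1. *)
  rewrite /x /magn2 (bigD1 [ffun=> 0]) //= ler_wpDr //.
    by rewrite sumr_ge0 // => t _; rewrite mulr_ge0 ?sqr_ge0 // mixture_ge0.
  rewrite /magnetization /mixture /P !cond_law0 !ffunE /= mulr0 mulr1 addr0 subr0.
  rewrite mul1r expr2 mulrA divff ?gt_eqF // mul1r invf_ge1 //.
  by rewrite -p_sum lerDl ltW.
have xlow : forall n, xmin <= x n.
  apply: (persist l x w el (ltW l1) x0) => n.
  - exact: normr_magn3_le.
  - by rewrite xS; have [_ + _] := stepn n.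
  - by rewrite xS -dth; have [+ _ _] := stepn n.
  - by move=> t t0; rewrite wS; have [_ _] := stepn n; apply.
exists 0, 1.
apply: (@limn_esup_gt0 _ _ (2^-1 * (p 0 0 * p 0 1 * xmin))).
  by rewrite !mulr_gt0.
move=> n; rewrite /dTV ler_wpM2l // mulrC -ler_pdivlMr // mulrC.
apply: le_trans (xlow n) _.
rewrite (le_trans (magn2_le_dist (p_gt0 0) (p_gt0 1) p_sum (P_ge0 n 0) (P_ge0 n 1))) //.
rewrite ler_wpM2l // ler_sum // => t _.
by rewrite !level_law_cond_law // gt_eqF.
Qed.
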